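(* Let $C$ be a closed, convex and non-empty subset of $\mathbb{R}^n$, let $h:\mathbb{R}^n\to\mathbb{R}$ be a function and let $K:C\rightrightarrows\mathbb{R}^n$ be a set-valued map with non-empty values such that $K(C)$ is relatively compact. Let $P_C$ be the Euclidean projection onto $C$. Assume that 1. $K$ is lower semicontinuous with convex values; 2. the set $D=\{(x,z)\in C\times\mathbb{R}^n: z\in K(x)\text{ and }x\in P_C(z)\}$ is closed; 3. the set-valued map $H:D\rightrightarrows\mathbb{R}^n$ defined by $H(x,z)=\{y\in K(x): h(z)>h(y)\}$ is lower semicontinuous with convex values. Then there exists a projected solution of the quasi-optimization problem associated to $h$ and $K$, i.e. there exist $x_0\in C$ and $z_0\in K(x_0)$ such that $h(z_0)\le h(z)$ for all $z\in K(x_0)$ and $x_0\in P_C(z_0)$.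
   Context: $\|\cdot\|$ is the Euclidean norm and $P_C(z)=\{x\in C:\|z-x\|\le\|z-w\|\ \text{for all } w\in C\}$. $K(C)=\bigcup_{x\in C}K(x)$. Values of set-valued maps may be empty unless stated otherwise. A set-valued map $\Phi:X\rightrightarrows Y$ is lower semicontinuous if for any $x_0$, any net $(x_i)$ converging to $x_0$ and any $y_0\in \Phi(x_0)$, there exist a subnet $(x_{\varphi(j)})_{j\in J}$ and a net $(y_j)_{j\in J}$ converging to $y_0$ with $y_j\in\Phi(x_{\varphi(j)})$ for all $j$. A projected solution of the quasi-optimization problem is a point $x_0\in C$ for which there exists $z_0\in\mathrm{argmin}_{z\in K(x_0)}h(z)$ with $x_0\in P_C(z_0)$. *)

(* Defs.v *)
From mathcomp Require Import all_boot all_order all_algebra.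
From mathcomp Require Import all_classical all_reals all_analysis.

Set Implicit Arguments.
Unset Strict Implicit.
Unset Printing Implicit Defensive.

Import Order.TTheory GRing.Theory Num.Theory.
Import numFieldNormedType.Exports.

Local Open Scope classical_set_scope.
Local Open Scope ring_scope.

Definition directed (I : Type) (le : I -> I -> Prop) : Prop :=
  [/\ [set: I] !=set0,
      (forall i, le i i),
      (forall i j k, le i j -> le j k -> le i k) &
      (forall i j, exists k, le i k /\ le j k)].

Definition net_cvg (T : topologicalType) (I : Type) (le : I -> I -> Prop)
    (x : I -> T) (x0 : T) : Prop :=
  x @ filter_from [set: I] (fun i => [set j | le i j]) --> x0.

(* [x \o phi] is a subnet of [x] in the sense of Kelley: no monotonicity of
   [phi] is required. *)
Definition subnet_map (I J : Type) (leI : I -> I -> Prop)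
    (leJ : J -> J -> Prop) (phi : J -> I) : Prop :=
  forall i0, exists j0, forall j, leJ j0 j -> leI i0 (phi j).

(* A set-valued map with domain [X] is represented by a total function [Phi]
   whose values outside [X] are never used; nets are nets of points of [X]. *)
Definition lower_semicontinuous_on (T U : topologicalType) (X : set T)
    (Phi : T -> set U) : Prop :=
  forall (x0 : T), X x0 ->
  forall (I : Type) (leI : I -> I -> Prop) (x : I -> T),
    directed leI -> (forall i, X (x i)) -> net_cvg leI x x0 ->
  forall y0 : U, Phi x0 y0 ->
  exists (J : Type) (leJ : J -> J -> Prop) (phi : J -> I) (y : J -> U),
    [/\ directed leJ,
        subnet_map leI leJ phi,
        net_cvg leJ y y0 &
        forall j, Phi (x (phi j)) (y j)].

(* The norm [`|x|] of the library on ['rV[R]_n] is the sup norm; it induces the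
   same topology but not the same projection. *)
Definition enorm (R : realType) (n : nat) (x : 'rV[R]_n) : R :=
  Num.sqrt (\sum_(i < n) x ord0 i ^+ 2).

Definition proj_set (R : realType) (n : nat) (C : set 'rV[R]_n)
    (z : 'rV[R]_n) : set 'rV[R]_n :=
  [set x | C x /\ forall w, C w -> enorm (z - x) <= enorm (z - w)].

Definition argmin_set (R : realType) (T : Type) (A : set T) (h : T -> R) :
    set T :=
  [set z | A z /\ forall w, A w -> h z <= h w].

Definition projected_solution (R : realType) (n : nat) (C : set 'rV[R]_n)
    (h : 'rV[R]_n -> R) (K : 'rV[R]_n -> set 'rV[R]_n) (x0 : 'rV[R]_n) : Prop :=
  C x0 /\ exists2 z0, argmin_set (K x0) h z0 & proj_set C z0 x0.

Definition proj_graph (R : realType) (n : nat) (C : set 'rV[R]_n)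
    (K : 'rV[R]_n -> set 'rV[R]_n) : set ('rV[R]_n * 'rV[R]_n) :=
  [set p | [/\ C p.1, K p.1 p.2 & proj_set C p.2 p.1]].

Definition improvement_map (R : realType) (n : nat) (h : 'rV[R]_n -> R)
    (K : 'rV[R]_n -> set 'rV[R]_n) (p : 'rV[R]_n * 'rV[R]_n) :
    set 'rV[R]_n :=
  [set y | K p.1 y /\ h p.2 > h y].

(* Main.v *)
(* Suppose there is no projected solution, and let [pi] be the projection onto
   [C].  The map sending [z] to [H(pi z, z)] when [(pi z, z)] lies in the closed
   set [D], and to [K(pi z)] otherwise, is then lower semicontinuous with
   non-empty convex values in a cube.  Such a map has a continuous selection
   (Michael; the values need not be closed, since the dimension is finite), so
   by Brouwer's theorem it has a fixed point [z].  Then [z] is in [K(pi z)], so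
   [(pi z, z)] is in [D] and [z] is in [H(pi z, z)], that is [h z < h z].

   Brouwer's theorem comes from a combinatorial Poincare-Miranda theorem: for
   [u_1, ..., u_n : {0..K}^n -> F_2] with [u_i = 0] on [x_i = 0] and [u_i = 1]
   on [x_i = K], the sum over the unit cubes of the cubical cup product
   [d u_1 \cup ... \cup d u_n] is [1] by the discrete Stokes formula, so on some
   unit cube every [u_i] takes both values.

   For the selection [f], countably many selections [g_j] of the closures of
   suitable submaps are built so that the values [g_j z] are dense in [T z]; then
   the average [f z] of the [g_j z] with positive weights belongs to [T z]. *)

Require Import Defs.
From mathcomp Require Import all_boot all_order all_algebra.
From mathcomp Require Import all_classical all_reals all_analysis.
From mathcomp Require Import finmap ring lra zify.
Set Implicit Arguments.
Unset Strict Implicit.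
Unset Printing Implicit Defensive.
Import Order.TTheory GRing.Theory Num.Theory.
Import numFieldNormedType.Exports.
Local Open Scope ring_scope.

(** * Discrete Poincare-Miranda theorem *)

Section Discrete.
Variable n : nat.
Local Notation pt := ('I_n -> nat).
Local Notation F2 := 'F_2.

Definition upd (a : pt) (k : 'I_n) (t : nat) : pt :=
  fun i => if i == k then t else a i.
Definition step (k : 'I_n) (a : pt) : pt := upd a k (a k).+1.
Definition dif (k : 'I_n) (F : pt -> F2) (a : pt) : F2 := F (step k a) - F a.

(* Cubical cup product of the coboundaries of the functions in [us], evaluated
   on the face spanned at [a] by the directions in [S]; meaningful when
   [#|S| = size us]. *)
Fixpoint cup (us : seq (pt -> F2)) (S : {set 'I_n}) (a : pt) : F2 :=
  if us is u :: us' then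
    \sum_(k in S) dif k u a * cup us' (S :\ k) (step k a)
  else 1.

Lemma upd_upd a k t t' : upd (upd a k t) k t' = upd a k t'.
Proof. by apply/funext => i; rewrite /upd; case: eqP. Qed.

Lemma updC a k l t t' : k != l -> upd (upd a k t) l t' = upd (upd a l t') k t.
Proof.
move=> kl; apply/funext => i; rewrite /upd.
by have [->|//] := eqVneq i l; rewrite eq_sym (negbTE kl).
Qed.

Lemma upd_eq a k t : upd a k t k = t.
Proof. by rewrite /upd eqxx. Qed.

Lemma upd_neq a k l t : l != k -> upd a k t l = a l.
Proof. by rewrite /upd => /negbTE ->. Qed.

Lemma step_upd a k t : step k (upd a k t) = upd a k t.+1.
Proof. by rewrite /step upd_eq upd_upd. Qed.

Lemma upd_step a k l t : k != l -> step l (upd a k t) = upd (step l a) k t.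
Proof. by move=> kl; rewrite /step upd_neq 1?eq_sym// updC. Qed.

Lemma stepC k l a : step k (step l a) = step l (step k a).
Proof.
have [->//|kl] := eqVneq k l.
by rewrite {2 4}/step upd_step 1?eq_sym// /step !upd_neq// eq_sym.
Qed.

Lemma F2_addxx (x : F2) : x + x = 0.
Proof. by rewrite -mulr2n -mulr_natr pchar_Zp ?mulr0. Qed.

(** The terms at [(k, l)] and [(l, k)] are equal, so they cancel in characteristic 2. *)
Lemma sum_sym_F2 (S : {set 'I_n}) (t : 'I_n -> 'I_n -> F2) :
  (forall k l, t k l = t l k) ->
  \sum_(k in S) \sum_(l in S :\ k) t k l = 0.
Proof.
move=> tC.
have split_lt k : \sum_(l in S :\ k) t k l =
    \sum_(l in S | (k < l)%N) t k l + \sum_(l in S | (l < k)%N) t k l.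
  rewrite (bigID (fun l : 'I_n => (k < l)%N)) /=; congr (_ + _);
    apply: eq_bigl => l; rewrite !inE; case: (ltngtP k l) => [kl|lk|/val_inj->].
  - by have -> : l != k by rewrite neq_ltn kl orbT.
  - by rewrite !andbF.
  - by rewrite !andbF.
  - by rewrite !andbF.
  - by have -> : l != k by rewrite neq_ltn lk.
  - by rewrite eqxx !andbF.
rewrite (eq_bigr _ (fun k _ => split_lt k)) big_split /=.
rewrite [X in _ + X](exchange_big_dep (fun l => l \in S)) /=; last first.
  by move=> k l _ /andP[].
rewrite [X in _ + X](eq_bigr (fun k : 'I_n => \sum_(l in S | (k < l)%N) t k l)).
  exact: F2_addxx.
by move=> k kS; apply: eq_big => [l|l _]; rewrite ?kS //= tC.
Qed.

(* The coboundary of [d u_1 \cup ... \cup d u_m] vanishes: by the Leibniz rule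
   only second differences remain, and they cancel in pairs modulo 2. *)
Lemma cup_closed us (S : {set 'I_n}) a :
  \sum_(k in S) dif k (cup us (S :\ k)) a = 0.
Proof.
elim: us S a => [|u us IH] S a /=.
  by rewrite big1// => k _; rewrite /dif subrr.
have leibniz k : dif k (cup (u :: us) (S :\ k)) a =
    \sum_(l in S :\ k) (dif l u (step k a) - dif l u a) *
        cup us (S :\ k :\ l) (step l (step k a)) +
    \sum_(l in S :\ k) dif l u a * dif k (cup us (S :\ k :\ l)) (step l a).
  rewrite {1}/dif /= -sumrB -big_split /=; apply: eq_bigr => l _.
  by rewrite [in RHS]/(dif k _ _) (stepC k l a); ring.
rewrite (eq_bigr _ (fun k _ => leibniz k)) big_split /= sum_sym_F2 ?add0r.
- rewrite (exchange_big_dep (fun l => l \in S)) /=; last first.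
    by move=> k l _; rewrite !inE => /andP[].
  rewrite big1// => l lS.
  transitivity (dif l u a *
      \sum_(k in S :\ l) dif k (cup us (S :\ l :\ k)) (step l a)).
    rewrite big_distrr /=.
    apply: eq_big => [k|k _]; first by rewrite !inE lS andbT eq_sym andbC.
    by rewrite finset.setDDl finset.setUC -finset.setDDl.
  by rewrite IH mulr0.
- move=> k l; rewrite (stepC l k) !finset.setDDl [in LHS]finset.setUC; congr (_ * _).
  by rewrite /dif (stepC k l) !opprB addrACA [RHS]addrACA; congr (_ + _);
    rewrite addrC.
Qed.

Variable K : nat.

(* Sum of [F] over the points whose coordinates in [s] run over [0..K-1], the
   other coordinates being those of [a]. *)
Fixpoint boxsum (s : seq 'I_n) (F : pt -> F2) (a : pt) : F2 :=
  if s is k :: s' then \sum_(t < K) boxsum s' F (upd a k t) else F a.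

Lemma eq_boxsum s F G a : F =1 G -> boxsum s F a = boxsum s G a.
Proof. by move=> /funext ->. Qed.

Lemma boxsum_sum s (P : pred 'I_n) (F : 'I_n -> pt -> F2) a :
  boxsum s (fun b => \sum_(k | P k) F k b) a = \sum_(k | P k) boxsum s (F k) a.
Proof.
elim: s a => [|k s IH] a //=; rewrite exchange_big /=.
by apply: eq_bigr => t _; rewrite IH.
Qed.

Lemma boxsumB s F G a :
  boxsum s (fun b => F b - G b) a = boxsum s F a - boxsum s G a.
Proof.
elim: s a => [|k s IH] a //=; rewrite -sumrB.
by apply: eq_bigr => t _; rewrite IH.
Qed.

Lemma boxsum_step s k F a : k \notin s ->
  boxsum s (fun b => F (step k b)) a = boxsum s F (step k a).
Proof.
elim: s a => [|l s IH] a //=; rewrite inE negb_or => /andP[kl ks].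
by apply: eq_bigr => t _; rewrite IH// upd_step// eq_sym.
Qed.

Lemma boxsum_dif_head k s F a : k \notin s ->
  boxsum (k :: s) (dif k F) a =
  boxsum s F (upd a k K) - boxsum s F (upd a k 0).
Proof.
move=> ks /=.
rewrite (eq_bigr (fun t : 'I_K =>
    boxsum s F (upd a k t.+1) - boxsum s F (upd a k t))); last first.
  by move=> t _; rewrite boxsumB boxsum_step// step_upd.
by rewrite -(big_mkord xpredT (fun t =>
    boxsum s F (upd a k t.+1) - boxsum s F (upd a k t))) telescope_sumr.
Qed.

Lemma boxsum_face0 s k F a : k \notin s ->
  (forall b, b k = a k -> F b = 0) -> boxsum s F a = 0.
Proof.
elim: s a => [|l s IH] a /=; first by move=> _; exact.
rewrite inE negb_or => /andP[kl ks] F0; rewrite big1// => t _.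
by apply: IH => // b; rewrite upd_neq//; exact: F0.
Qed.

(** Summing in direction [k] telescopes to the values on the faces [x_k = K] and [x_k = 0]. *)
Lemma boxsum_dif0 s k F a : uniq s -> k \in s ->
  (forall b, b k = 0%N \/ b k = K -> F b = 0) ->
  boxsum s (dif k F) a = 0.
Proof.
elim: s a => [//|l s IH] a /andP[ls us]; rewrite inE.
case: (eqVneq k l) => [-> _|kl /= ks] F0.
  rewrite boxsum_dif_head// !(@boxsum_face0 s l) ?subrr// => b;
  by rewrite upd_eq => bE; apply: F0; rewrite bE; auto.
by rewrite /= big1// => t _; exact: IH.
Qed.

Lemma step_neq k l a : l != k -> step k a l = a l.
Proof. exact: upd_neq. Qed.

(* The coboundary of [u k] vanishes along a face on which [u k] is constant. *)
Lemma cup_face0 (u : 'I_n -> pt -> F2) s (S : {set 'I_n}) (k : 'I_n) a :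
  k \notin S -> k \in s ->
  (forall b c, b k = a k -> c k = a k -> u k b = u k c) ->
  cup (map u s) S a = 0.
Proof.
move=> kS; elim: s S a kS => [//|l s IH] S a kS; rewrite inE /=.
move=> ks uk; rewrite big1// => j jS.
have jk : k != j by apply: contraNneq kS => ->.
case: (eqVneq k l) ks => [<- _|_ /= ks].
  by rewrite /dif (uk (step j a) a)// ?step_neq// subrr mul0r.
rewrite IH ?mulr0// ?inE ?negb_and ?kS ?orbT// => b c.
by rewrite step_neq//; exact: uk.
Qed.

(** Discrete Stokes formula, by induction on [s]: on the face [x_l = K] the factor [u l] is 1, and
    what remains is the same sum for the other functions. *)
Lemma cup_total (u : 'I_n -> pt -> F2) s a : uniq s ->
  (forall k b, b k = 0%N -> u k b = 0) -> (forall k b, b k = K -> u k b = 1) ->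
  boxsum s (cup (map u s) [set k in s]) a = 1.
Proof.
move=> us u0 u1; elim: s a us => [//|l s IH] a us.
have [ls us'] := andP us.
set S := [set k in l :: s]; set G := cup (map u s).
(* [d u_l \cup w = d (u_l \cup w)] since [w] is closed, so that the sum over the
   box telescopes; only the face [x_l = K] contributes. *)
have leib b : cup (map u (l :: s)) S b =
    \sum_(k in S) dif k (fun c => u l c * G (S :\ k) c) b.
  have -> : cup (map u (l :: s)) S b =
      cup (map u (l :: s)) S b + u l b * \sum_(k in S) dif k (G (S :\ k)) b.
    by rewrite cup_closed mulr0 addr0.
  rewrite /= big_distrr /= -big_split /=; apply: eq_bigr => k _.
  by rewrite /dif mulrBl mulrBr addrA subrK.
rewrite (eq_boxsum _ _ leib) boxsum_sum (bigD1 l) /=; last first.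
  by rewrite !inE eqxx.
have -> : S :\ l = [set k in s].
  by apply/finset.setP => k; rewrite !inE; case: eqP => // ->; rewrite (negbTE ls).
rewrite -[\sum_(t < K) _]/(boxsum (l :: s) (dif l _) a) boxsum_dif_head//.
rewrite (@boxsum_face0 s l _ (upd a l 0))//; last first.
  by move=> b; rewrite upd_eq => /u0 ->; rewrite mul0r.
(* For [k] other than [l], the function being differenced contains the coboundary of [u k], which
   vanishes on both faces orthogonal to [k]. *)
rewrite subr0 big1 ?addr0; last first.
  move=> k /andP[kS kl].
  have ks : k \in s by move: kS; rewrite !inE (negbTE kl).
  rewrite -[\sum_(t < K) _]/(boxsum (l :: s) (dif k _) a) boxsum_dif0 ?inE ?ks ?orbT//.
  move=> b bk; rewrite /G (@cup_face0 u s (S :\ k) k)// ?mulr0 ?inE ?eqxx//.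
  move=> c d; case: bk => -> ck dk; first by rewrite !u0.
  by rewrite !u1.
transitivity (boxsum s (G [set k in s]) (upd a l K)); last exact: IH.
have lem : forall r b, l \notin r -> b l = K ->
  boxsum r (fun c => u l c * G [set k in s] c) b = boxsum r (G [set k in s]) b.
  elim=> [|k r IHr] b /=; first by move=> _ /u1 ->; rewrite mul1r.
  rewrite inE negb_or => /andP[lk lr] bl; apply: eq_bigr => t _.
  by rewrite IHr// upd_neq.
by rewrite lem// upd_eq.
Qed.

Lemma boxsum_neq0 s F a : boxsum s F a != 0 ->
  exists2 b, F b != 0 &
    forall k, if k \in s then (b k < K)%N else b k == a k.
Proof.
elim: s a => [|l s IH] a /=; first by exists a => // k.
move=> /eqP sN0.
have [t /eqP tN0] : exists t : 'I_K, boxsum s F (upd a l t) <> 0.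
  apply/existsNP => t0; apply: sN0; rewrite big1// => t _; exact: t0.
have [b Fb bP] := IH _ tN0; exists b => // k.
move: (bP k); rewrite inE; case: (k \in s); first by rewrite orbT.
rewrite orbF; case: (eqVneq k l) => [->|kl].
  by rewrite upd_eq => /eqP ->.
by rewrite upd_neq.
Qed.

(** Following a nonzero summand at each level of the recursion gives an edge path from [a] inside
    the cube, and each [u k] changes along one of its edges. *)
Lemma cup_neq0 (u : 'I_n -> pt -> F2) s (S : {set 'I_n}) a :
  cup (map u s) S a != 0 ->
  forall k, k \in s -> exists b c : pt,
    [/\ u k b <> u k c, (forall i, (a i <= b i <= a i + (i \in S))%N) &
        (forall i, (a i <= c i <= a i + (i \in S))%N)].
Proof.
elim: s S a => [//|l s IH] S a /= /eqP sN0 k.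
have [j /eqP] : exists j, (if j \in S then dif j (u l) a *
    cup [seq u i | i <- s] (S :\ j) (step j a) else 0) <> 0.
  apply/existsNP => t0; apply: sN0; rewrite big1// => t tS.
  by have := t0 t; rewrite tS.
case: ifP => [jS|]; last by rewrite eqxx.
rewrite mulf_eq0 negb_or => /andP[d0 w0].
have stepa i : (a i <= step j a i <= a i + (i \in S))%N.
  have [->|ij] := eqVneq i j; first by rewrite /step upd_eq jS addn1 leqnSn leqnn.
  by rewrite step_neq// leqnn leq_addr.
rewrite inE => /orP[/eqP ->|ks].
  exists (step j a), a; split => //; last by move=> i; rewrite leqnn leq_addr.
  by move: d0; rewrite subr_eq0 => /eqP.
have [b [c [bc bP cP]]] := IH _ _ w0 k ks.
suff tr (d : pt) : (forall i, (step j a i <= d i <= step j a i + (i \in S :\ j))%N) ->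
   forall i, (a i <= d i <= a i + (i \in S))%N.
  by exists b, c; split => //; exact: tr.
move=> dP i; move: (dP i); rewrite !inE.
have [->|ij] := eqVneq i j; last by rewrite step_neq.
rewrite /step upd_eq jS /= addn0 addn1 => /andP[h1 h2]; rewrite h2 andbT.
exact: ltnW.
Qed.

Lemma poincare_miranda (u : 'I_n -> pt -> bool) :
  (forall k b, b k = 0%N -> u k b = false) ->
  (forall k b, b k = K -> u k b = true) ->
  exists2 a : pt, forall k, (a k < K)%N &
    forall k, exists b c : pt,
      [/\ u k b, ~~ u k c, (forall i, (a i <= b i <= (a i).+1)%N) &
          (forall i, (a i <= c i <= (a i).+1)%N)].
Proof.
move=> u0 u1; pose v k b : F2 := (u k b)%:R.
have : boxsum (enum 'I_n) (cup (map v (enum 'I_n)) [set k in enum 'I_n])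
    (fun=> 0%N) != 0.
  rewrite cup_total ?oner_eq0 ?enum_uniq// => k b bk.
    by rewrite /v u0.
  by rewrite /v u1.
move=> /boxsum_neq0[a /cup_neq0 aN0 aK]; exists a.
  by move=> k; have := aK k; rewrite mem_enum.
move=> k; have [|b [c [bc bP cP]]] := aN0 k; first by rewrite mem_enum.
have wk (d : pt) : (forall i, (a i <= d i <= a i + (i \in [set k in enum 'I_n]))%N) ->
   forall i, (a i <= d i <= (a i).+1)%N.
  by move=> dP i; have := dP i; rewrite inE mem_enum addn1.
move: bc; rewrite /v; case ub: (u k b); case uc: (u k c) => // _.
  by exists b, c; rewrite ub uc; split => //; exact: wk.
by exists c, b; rewrite ub uc; split => //; exact: wk.
Qed.

End Discrete.

Local Open Scope classical_set_scope.

(** * Brouwer's theorem on a cube *)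

Lemma rV_norm_leP (R : realType) n (x : 'rV[R]_n) (M : R) : 0 <= M ->
  reflect (forall i, `|x ord0 i| <= M) (`|x| <= M).
Proof.
move=> M0; have -> : `|x| = mx_norm x by []. rewrite mx_normrE; apply: (iffP idP).
  by move/bigmax_leP => [_ xM] i; exact: (xM (ord0, i)).
by move=> xM; apply/bigmax_leP; split => // -[i j] _ /=; rewrite ord1.
Qed.

Lemma rV_norm_coord (R : realType) n (x : 'rV[R]_n) i : `|x ord0 i| <= `|x|.
Proof. exact/(rV_norm_leP _ (normr_ge0 x)). Qed.

Lemma invS_lt (R : realType) (e : R) : 0 < e ->
  exists N0 : nat, forall N, (N0 <= N)%N -> N.+1%:R^-1 < e.
Proof.
by move=> e0; have [N0 _ N0P] := near_infty_natSinv_lt (PosNum e0); exists N0.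
Qed.

Definition cube (R : realType) n (M : R) : set 'rV[R]_n := [set z | `|z| <= M].
Arguments cube {R} n M.

Lemma closed_norm_ball (R : realType) (V : normedModType R) (c : V) (r : R) :
  closed [set z | `|z - c| <= r].
Proof.
rewrite -[X in closed X]/((fun z => `|z - c|) @^-1` [set s | s <= r]).
apply: preimage_closed (@closed_le R r) => z _.
by apply: cvg_norm; apply: cvgB; [exact: cvg_id|exact: cvg_cst].
Qed.

Lemma cube_compact (R : realType) n (M : R) : compact (cube n M).
Proof.
apply: bounded_closed_compact.
  by exists M; split; rewrite ?num_real// => t Mt x; move=> /le_trans; apply; exact: ltW.
rewrite (_ : cube n M = [set z | `|z - 0| <= M]); first exact: closed_norm_ball.
by apply/seteqP; split => z; rewrite /cube /= subr0.
Qed.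

Lemma compact_seq_cluster (R : realType) (V : normedModType R) (A : set V)
    (X : nat -> V) : compact A -> (forall N, A (X N)) ->
  exists2 z, A z & forall e, 0 < e -> forall N0, exists2 N, (N0 <= N)%N &
    `|X N - z| < e.
Proof.
move=> cA AX; have [|z [Az clz]] := cA (X @ \oo) _.
  by exists 0%N => // N _; exact: AX.
exists z => // e e0 N0.
have FN0 : (X @ \oo) [set X N | N in [set N | (N0 <= N)%N]].
  by exists N0 => // N /= N0N; exists N.
have [_ [[N N0N <-] zN]] := clz _ _ FN0 (nbhsx_ballx z e e0).
by exists N => //; move: zN; rewrite -ball_normE /= distrC.
Qed.

(** Continuity relative to [E]: the selections below take arbitrary values off [E], so only points
    of [E] are compared. *)
Definition cont_on (R : realType) (V W : normedModType R) (E : set V)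
    (f : V -> W) : Prop :=
  forall z, E z -> forall e, 0 < e -> exists2 d, 0 < d &
    forall z', E z' -> `|z' - z| < d -> `|f z' - f z| < e.

(** On a grid of mesh [2 * M / (N + 1)], colour a point by the sign of the [k]-th coordinate of
    [f x - x]. Poincare-Miranda yields a small cube on which every coordinate takes both signs; such
    cubes cluster at a fixed point as the mesh tends to 0. *)
Lemma brouwer_cube (R : realType) n (M : R) (f : 'rV[R]_n -> 'rV[R]_n) :
  0 < M -> cont_on (cube n M) f -> (forall z, cube n M z -> cube n M (f z)) ->
  exists2 z, cube n M z & f z = z.
Proof.
move=> M0 fc fM.
have approx N : exists2 x, cube n M x & forall k : 'I_n,
    exists y z, [/\ cube n M y, cube n M z, `|y - x| <= 2 * M * N.+1%:R^-1,
      `|z - x| <= 2 * M * N.+1%:R^-1 &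
      f y ord0 k <= y ord0 k /\ z ord0 k <= f z ord0 k].
  pose K := N.+1; pose t (j : nat) : R := - M + 2 * M * (j%:R / K%:R).
  have K0 : (0 : R) < K%:R by rewrite ltr0n.
  have tM j : (j <= K)%N -> `|t j| <= M.
    move=> jK; have : 0 <= (j%:R / K%:R : R) <= 1.
      by rewrite divr_ge0//= ler_pdivrMr// mul1r ler_nat.
    by rewrite /t ler_norml; move: (_ / _) => q; nra.
  have tt i j : (i <= j <= i.+1)%N -> `|t j - t i| <= 2 * M * N.+1%:R^-1.
    move=> /andP[ij ji].
    have -> : t j - t i = 2 * M * N.+1%:R^-1 * (j%:R - i%:R).
      by rewrite /t; ring.
    rewrite normrM ger0_norm ?mulr_ge0 ?invr_ge0 ?ler0n ?(ltW M0)//.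
    rewrite ler_piMr ?mulr_ge0 ?invr_ge0 ?ler0n ?(ltW M0)//.
    rewrite -natrB// ger0_norm ?ler0n// lern1; lia.
  pose x (b : 'I_n -> nat) : 'rV[R]_n := \row_i t (b i).
  have xM b : (forall i, (b i <= K)%N) -> cube n M (x b).
    move=> bK; apply/rV_norm_leP; first exact: ltW.
    by move=> i; rewrite mxE; exact: tM.
  have xx a b : (forall i, (a i <= b i <= (a i).+1)%N) ->
      `|x b - x a| <= 2 * M * N.+1%:R^-1.
    move=> ab; apply/rV_norm_leP.
      by rewrite ?mulr_ge0 ?invr_ge0 ?ler0n ?(ltW M0).
    by move=> i; rewrite !mxE; exact: tt.
  (* Forcing the values on the faces is harmless since [f] maps the cube to
     itself. *)
  pose u k b := (b k != 0%N) && ((b k == K) || (f (x b) ord0 k <= x b ord0 k)).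
  have [||a aK ua] := @poincare_miranda n K u.
  - by move=> k b; rewrite /u => ->.
  - by move=> k b; rewrite /u => ->; rewrite eqxx.
  have bK b : (forall i, (a i <= b i <= (a i).+1)%N) -> cube n M (x b).
    move=> ab; apply: xM => i; have /andP[_ /leq_trans] := ab i; apply.
    exact: aK.
  exists (x a); first by apply: bK => i; rewrite leqnn leqnSn.
  move=> k; have [b [c [ub uc ab ac]]] := ua k.
  exists (x b), (x c); split; [exact: bK|exact: bK|exact: xx|exact: xx|].
  have fle d : cube n M (x d) -> - M <= f (x d) ord0 k <= M.
    move=> /fM xd; rewrite -ler_norml; apply: le_trans xd; exact: rV_norm_coord.
  split.
  - case/andP: ub => _ /orP[/eqP bk|//].
    have /andP[_ ] := fle _ (bK _ ab); rewrite mxE /t bk divff ?gt_eqF// => ?; lra.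
  - move: uc; rewrite /u negb_and negbK => /orP[/eqP ck|].
      have /andP[+ _] := fle _ (bK _ ac); rewrite [x c _ _]mxE /t ck mul0r => ?; lra.
    by rewrite negb_or -ltNge => /andP[_ /ltW].
have /choice[X XP] : forall N, exists x, cube n M x /\
    forall k : 'I_n, exists y z, [/\ cube n M y, cube n M z,
      `|y - x| <= 2 * M * N.+1%:R^-1, `|z - x| <= 2 * M * N.+1%:R^-1 &
      f y ord0 k <= y ord0 k /\ z ord0 k <= f z ord0 k].
  by move=> N; have [x xM xP] := approx N; exists x.
have [z zM zX] := compact_seq_cluster (cube_compact (n:=n) (M:=M)) (fun N => (XP N).1).
exists z => //; apply/rowP => k; apply/eqP.
rewrite -subr_eq0 -normr_le0; apply/ler_addgt0Pl => e e0; rewrite addr0.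
have e2 : 0 < e / 2 by rewrite divr_gt0.
have [d d0 fd] := fc z zM _ e2.
pose r := Num.min d (e / 2); have r0 : 0 < r by rewrite lt_min d0.
(* The bound [r / (4 * M)] makes the mesh smaller than [r / 2]; the distance from [X N] to [z] takes
   the other half of [r]. *)
have [N0 N0P] := invS_lt (divr_gt0 r0 (mulr_gt0 (ltr0n R 4) M0)).
have r2 : 0 < r / 2 by rewrite divr_gt0.
have [N N0N XNz] := zX _ r2 N0.
have near y : `|y - X N| <= 2 * M * N.+1%:R^-1 -> `|y - z| < r.
  move=> yX; rewrite -(subrK (X N) y) -addrA (le_lt_trans (ler_normD _ _))//.
  rewrite [r]splitr ltr_leD//; last exact: ltW.
  rewrite (le_lt_trans yX)//; have := N0P _ N0N.
  rewrite ltr_pdivlMr ?mulr_gt0//; move: (N.+1%:R^-1) => q qr.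
  by clear -qr; clearbody r; lra.
have coord y : cube n M y -> `|y - X N| <= 2 * M * N.+1%:R^-1 ->
    `|f y ord0 k - f z ord0 k| < e / 2 /\ `|y ord0 k - z ord0 k| < e / 2.
  move=> yM /near; rewrite lt_min => /andP[yd ye].
  have := fd _ yM yd => fyz; split.
    by rewrite (le_lt_trans _ fyz)//; have := rV_norm_coord (f y - f z) k; rewrite !mxE.
  by rewrite (le_lt_trans _ ye)//; have := rV_norm_coord (y - z) k; rewrite !mxE.
(* The point [y] bounds the [k]-th coordinate of [f z - z] from above, and [w] bounds it from
   below. *)
have [y [w [yM wM yX wX [fy fw]]]] := (XP N).2 k.
have [] := coord _ yM yX; have [] := coord _ wM wX.
rewrite !ltr_norml ler_norml => /andP[? ?] /andP[? ?] /andP[? ?] /andP[? ?].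
by apply/andP; split; lra.
Qed.

(** * Selections of the closure *)

Definition cvx (R : realType) (V : lmodType R) (A : set V) : Prop :=
  forall x y (t : R), A x -> A y -> 0 <= t -> t <= 1 ->
  A (t *: x + (1 - t) *: y).

(** Metric counterpart of [lower_semicontinuous_on], obtained from nets in [lsc_on_of_nets]. *)
Definition lsc_on (R : realType) (V W : normedModType R) (E : set V)
    (T : V -> set W) : Prop :=
  forall z y, E z -> T z y -> forall e, 0 < e -> exists2 d, 0 < d &
    forall z', E z' -> `|z' - z| < d -> exists2 y', T z' y' & `|y' - y| < e.

(** Shaped for unnormalized partitions of unity: [y i] has to lie in [A] only where its weight is
    positive. *)
Lemma cvx_sum (R : realType) (V : lmodType R) (A : set V) (I : Type)
    (s : seq I) (w : I -> R) (y : I -> V) : cvx A ->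
  (forall i, 0 <= w i) -> (forall i, 0 < w i -> A (y i)) ->
  0 < \sum_(i <- s) w i ->
  A ((\sum_(i <- s) w i)^-1 *: \sum_(i <- s) w i *: y i).
Proof.
(* The case of total weight 0 is carried along, since the tail of the list may have only zero
   weights. *)
move=> cA w0 wA; suff : (\sum_(i <- s) w i = 0 -> \sum_(i <- s) w i *: y i = 0)
    /\ (0 < \sum_(i <- s) w i ->
        A ((\sum_(i <- s) w i)^-1 *: \sum_(i <- s) w i *: y i)) by case.
elim: s => [|i s [IH0 IH]].
  by rewrite !big_nil; split => //; rewrite ltxx.
have S0 : 0 <= \sum_(j <- s) w j by rewrite sumr_ge0.
rewrite !big_cons; move: S0 IH0 IH.
set S := \sum_(j <- s) w j; set Y := \sum_(j <- s) _ => S0 IH0 IH.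
split.
  move=> /eqP; rewrite paddr_eq0// => /andP[/eqP -> /eqP /IH0 ->].
  by rewrite scale0r addr0.
move=> wS; have [wi0|wi0] := eqVneq (w i) 0.
  by rewrite wi0 scale0r !add0r; apply: IH; rewrite wi0 add0r in wS.
have {}wi0 : 0 < w i by rewrite lt_def wi0 w0.
have [SE|SN0] := eqVneq S 0.
  by rewrite SE IH0// !addr0 scalerA mulVf ?gt_eqF// scale1r; exact: wA.
have {}S0 : 0 < S by rewrite lt_def SN0.
have t0 : 0 <= w i / (w i + S) by rewrite divr_ge0 ?ltW.
have t1 : w i / (w i + S) <= 1.
  by rewrite ler_pdivrMr// mul1r lerDl ltW.
have := cA _ _ _ (wA _ wi0) (IH S0) t0 t1.
congr (A _); rewrite scalerDr !scalerA; congr (_ *: _ + _ *: _).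
  by rewrite mulrC.
by field; rewrite !gt_eqF.
Qed.

Lemma cvx_thick (R : realType) (V : normedModType R) (A : set V) (e : R) :
  cvx A -> cvx [set w | exists2 y, A y & `|w - y| < e].
Proof.
move=> cA w w' t [y Ay wy] [y' Ay' wy'] t0 t1.
exists (t *: y + (1 - t) *: y'); first exact: cA.
rewrite opprD addrACA -!scalerBr (le_lt_trans (ler_normD _ _))//.
rewrite !normrZ (ger0_norm t0) ger0_norm ?subr_ge0//.
move: `|w - y| `|w' - y'| wy wy' => a b ? ?.
by have [ab|ba] := leP a b; nra.
Qed.

Lemma cvg_cont_on (R : realType) (V W : normedModType R) (E : set V)
    (f : V -> W) : (forall z, E z -> f x @[x --> z] --> f z) -> cont_on E f.
Proof.
move=> fc z Ez e e0; have /cvgrPdist_lt/(_ e e0) := fc z Ez.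
rewrite near_nbhs => /nbhs_ballP[d /= d0 fd]; exists d => // z' Ez' z'd.
by rewrite distrC; apply: fd; rewrite -ball_normE /= distrC.
Qed.

Lemma lsc_on_near (R : realType) (V W : normedModType R) (E : set V)
    (T : V -> set W) (f : V -> W) (r : R) : lsc_on E T -> cont_on E f ->
  lsc_on E (fun z => [set y | T z y /\ `|y - f z| < r]).
Proof.
move=> lT cf z y Ez [Ty yr] e e0.
(* Half of the slack in [|y - f z| < r], because an error is made twice: from [y] to [y'] and from
   [f z] to [f z']. *)
pose s := Num.min e ((r - `|y - f z|) / 2).
have s0 : 0 < s by rewrite lt_min e0 divr_gt0// subr_gt0.
have [d1 d10 Td] := lT z y Ez Ty s s0; have [d2 d20 fd] := cf z Ez s s0.
exists (Num.min d1 d2); first by rewrite lt_min d10.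
move=> z' Ez'; rewrite lt_min => /andP[zd1 zd2].
have [y' Ty' y'y] := Td z' Ez' zd1; have fz := fd z' Ez' zd2.
exists y'; last by move: y'y; rewrite lt_min => /andP[].
split => //; have -> : y' - f z' = (y' - y) + (y - f z) + (f z - f z').
  by rewrite !addrA !subrK.
rewrite (le_lt_trans (ler_normD _ _))// (le_lt_trans (lerD (ler_normD _ _) (lexx _)))//.
move: y'y fz; rewrite !lt_min => /andP[_ y'y] /andP[_]; rewrite distrC.
move: y'y; move: `|y' - y| `|y - f z| `|f z - f z'| => a b c; lra.
Qed.

(* By the inclusion hypothesis, the value is [T' z] on [F] and [T z] off [F]. *)
Lemma lsc_on_patch (R : realType) (V W : normedModType R) (E F : set V)
    (T T' : V -> set W) : closed F -> lsc_on E T -> lsc_on (E `&` F) T' ->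
  (forall z, F z -> T' z `<=` T z) ->
  lsc_on E (fun z => [set y | T z y /\ (F z -> T' z y)]).
Proof.
move=> clF lT lT' TT z y Ez [Ty T'y] e e0.
have [d1 d10 Td] := lT z y Ez Ty e e0.
have [Fz|nFz] := pselect (F z).
  have [d2 d20 Td'] := lT' z y (conj Ez Fz) (T'y Fz) e e0.
  exists (Num.min d1 d2); first by rewrite lt_min d10.
  move=> z' Ez'; rewrite lt_min => /andP[zd1 zd2].
  have [Fz'|nFz'] := pselect (F z').
    have [y' T'y' y'y] := Td' z' (conj Ez' Fz') zd2.
    by exists y' => //; split => //; exact: TT.
  by have [y' Ty' y'y] := Td z' Ez' zd1; exists y'.
have /nbhs_ballP[d2 /= d20 dF] : nbhs z (~` F).
  by apply: open_nbhs_nbhs; split => //; exact: closed_openC.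
exists (Num.min d1 d2); first by rewrite lt_min d10.
move=> z' Ez'; rewrite lt_min => /andP[zd1 zd2].
have [y' Ty' y'y] := Td z' Ez' zd1; exists y' => //; split => // Fz'.
by have := dF z'; rewrite -ball_normE /= distrC => /(_ zd2).
Qed.

(** Near each point of [E] some constant is within [e] of [T]. Finitely many of these neighbourhoods
    cover [E], and a partition of unity glues the constants; convexity of the [e]-thickening of
    [T z] keeps the average within [e]. *)
Lemma approx_selection (R : realType) (V W : normedModType R) (E : set V)
    (T : V -> set W) (e : R) : compact E -> lsc_on E T ->
  (forall z, E z -> cvx (T z)) -> (forall z, E z -> T z !=set0) -> 0 < e ->
  exists f : V -> W, cont_on E f /\
    forall z, E z -> exists2 y, T z y & `|f z - y| < e.
Proof.
move=> cE lT cT T0 e0.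
(* The pair is a constant and a radius; off [E] the radius 0 makes both clauses vacuous. *)
have /choice[g gP] : forall z, exists p : W * R,
    (E z -> 0 < p.2) /\ (0 < p.2 -> forall z', E z' -> `|z' - z| < p.2 ->
      exists2 y, T z' y & `|y - p.1| < e).
  move=> z; have [Ez|nEz] := pselect (E z); last first.
    by exists (0, 0); rewrite /= ltxx.
  have [y Ty] := T0 z Ez; have [d d0 Td] := lT z y Ez Ty e e0.
  by exists (y, d).
have [D DE Ecov] : finite_subset_cover E (fun z => ball z (g z).2) E.
  move: cE; rewrite compact_cover; apply.
  - by move=> z Ez; apply: ball_open; exact: (gP z).1.
  - by move=> z Ez; exists z => //; apply: ballxx; exact: (gP z).1.
(* Unnormalized partition of unity [phi i = a i + |a i|], supported in the ball
   of centre [i] and radius [(g i).2]. *)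
pose a i (z : V) := (g i).2 - `|z - i|; pose phi i z := a i z + `|a i z|.
pose S z := \sum_(i <- enum_fset D) phi i z.
pose f z := (S z)^-1 *: \sum_(i <- enum_fset D) phi i z *: (g i).1.
have phi0 i z : 0 <= phi i z by rewrite /phi -lerBlDl sub0r ler_normr lexx orbT.
have phi_gt0 i z : (0 < phi i z) = (`|z - i| < (g i).2).
  rewrite -[RHS]subr_gt0 -/(a i z) /phi; case: (ltrgt0P (a i z)) => [a0|a0|->].
  - by rewrite addr_gt0.
  - by rewrite subrr ltxx.
  - by rewrite addr0 ltxx.
have S0 z : E z -> 0 < S z.
  move=> Ez; have [i /= iD zi] := Ecov z Ez.
  rewrite /S (big_rem i)//= ltr_pwDl ?sumr_ge0//.
  by move: zi; rewrite phi_gt0 -ball_normE /= distrC.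
have phic i z : phi i x @[x --> z] --> phi i z.
  have ac : a i x @[x --> z] --> a i z.
    apply: cvgB; first exact: cvg_cst.
    by apply: cvg_norm; apply: cvgB; [exact: cvg_id|exact: cvg_cst].
  by apply: cvgD => //; exact: cvg_norm.
exists f; split.
  apply: cvg_cont_on => z Ez; apply: cvgZ.
    apply: cvgV; first by rewrite gt_eqF// S0.
    by apply: cvg_big; [exact: add_continuous|move=> i _]; exact: phic.
  by apply: cvg_big; [exact: add_continuous|move=> i _]; apply: cvgZr_tmp; exact: phic.
move=> z Ez.
apply: (cvx_sum (A := [set w | exists2 y, T z y & `|w - y| < e])) => //.
- exact/cvx_thick/cT.
- move=> i; rewrite phi_gt0 => zi.
  have [y Ty yg] := (gP i).2 (le_lt_trans (normr_ge0 _) zi) z Ez zi.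
  by exists y; rewrite // distrC.
- exact: S0.
Qed.
Lemma half_pow_lt (R : realType) (c e : R) : 0 < e ->
  exists k : nat, c * 2^-1 ^+ k < e.
Proof.
move=> e0; have [N0 /(_ N0 (leqnn _)) N0P] := invS_lt (divr_gt0 e0 (ltr_pwDl ltr01 (normr_ge0 c))).
exists N0.+1; rewrite (le_lt_trans (y := (1 + `|c|) * N0.+1%:R^-1))//; last first.
  by rewrite mulrC -ltr_pdivlMr// ltr_pwDl.
rewrite (le_trans (y := (1 + `|c|) * 2^-1 ^+ N0.+1))//.
  rewrite ler_wpM2r ?exprn_ge0 ?invr_ge0//.
  by rewrite (le_trans (ler_norm c))// lerDr.
rewrite ler_wpM2l ?addr_ge0// exprVn lef_pV2 ?posrE ?exprn_gt0//.
by rewrite -natrX ler_nat ltnW// ltn_expl.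
Qed.

Lemma geometric_lim (R : realType) n (u : nat -> 'rV[R]_n) (c : R) :
  (forall k, `|u k.+1 - u k| <= c * 2^-1 ^+ k) ->
  exists l, forall k, `|l - u k| <= 2 * c * 2^-1 ^+ k.
Proof.
move=> uc.
have c0 : 0 <= c by have := uc 0%N; rewrite expr0 mulr1; apply: le_trans.
have h0 k : 0 <= 2^-1 ^+ k :> R by rewrite exprn_ge0 ?invr_ge0.
have um k m : `|u (k + m)%N - u k| <= 2 * c * 2^-1 ^+ k.
  (* The factor [1 - 2^-m], coming from the finite geometric sum, makes the induction on [m] go
     through. *)
  suff : `|u (k + m)%N - u k| <= 2 * c * 2^-1 ^+ k * (1 - 2^-1 ^+ m).
    have m1 : 1 - 2^-1 ^+ m <= 1 :> R by rewrite gerBl.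
    by move/le_trans; apply; rewrite ler_piMr// !mulr_ge0.
  elim: m => [|m IH]; first by rewrite addn0 subrr normr0 expr0 subrr mulr0.
  rewrite addnS -(subrK (u (k + m)%N) (u (k + m).+1)) -addrA.
  rewrite (le_trans (ler_normD _ _))//.
  rewrite (le_trans (lerD (uc _) IH))// exprD exprS.
  set p := 2^-1 ^+ k; set q := 2^-1 ^+ m.
  suff -> : 2 * c * p * (1 - 2^-1 * q) =
    c * (p * q) + 2 * c * p * (1 - q) by [].
  by field.
have cu : cvgn u.
  apply/cauchy_cvgP/cauchy_exP => e e0.
  have [k kP] := half_pow_lt (2 * c) e0; exists (u k), k => // i /= ki.
  rewrite -ball_normE /= distrC (le_lt_trans _ kP)//.
  by have := um k (i - k)%N; rewrite subnKC.
exists (lim (u @ \oo)) => k; apply/ler_addgt0Pr => e e0.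
have /cvgrPdist_lt/(_ e e0)[N _ NP] := cu.
have /= := NP (k + N)%N (leq_addl _ _).
rewrite -[lim _ - u k](subrKA (u (k + N)%N)) => lN.
rewrite (le_trans (ler_normD _ _))// addrC lerD ?um// ltW//.
Qed.

(** Dependent choice with an invariant varying with the index: a successor is chosen for every pair
    [(k, a)], an arbitrary one where the invariant fails, and then iterated. *)
Lemma dep_choice_seq (A : Type) (P : nat -> A -> Prop)
    (r : nat -> A -> A -> Prop) : (exists a, P 0%N a) ->
  (forall k a, P k a -> exists2 b, P k.+1 b & r k a b) ->
  exists u : nat -> A, forall k, P k (u k) /\ r k (u k) (u k.+1).
Proof.
move=> [a0 Pa0] PS.
have /choice[g gP] : forall p : nat * A, exists b,
    P p.1 p.2 -> P p.1.+1 b /\ r p.1 p.2 b.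
  move=> [k a]; have [Pa|nPa] := pselect (P k a); last by exists a.
  by have [b Pb rb] := PS k a Pa; exists b.
pose u := nat_rect (fun=> A) a0 (fun k a => g (k, a)).
have Pu k : P k (u k) by elim: k => [//|k IH]; exact: (gP (k, u k) IH).1.
by exists u => k; split; [exact: Pu|exact: (gP (k, u k) (Pu k)).2].
Qed.

Lemma cont_on_unif (R : realType) (V W : normedModType R) (E : set V)
    (f : nat -> V -> W) (g : V -> W) : (forall k, cont_on E (f k)) ->
  (forall e, 0 < e -> exists k, forall z, E z -> `|g z - f k z| < e) ->
  cont_on E g.
Proof.
move=> cf fg z Ez e e0; have e3 : 0 < e / 3 by rewrite divr_gt0.
have [k kP] := fg _ e3; have [d d0 fd] := cf k z Ez _ e3.
exists d => // z' Ez' zd.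
have := fd z' Ez' zd; have := kP z Ez; have := kP z' Ez'.
have -> : g z' - g z = (g z' - f k z') + (f k z' - f k z) - (g z - f k z).
  by rewrite opprB !addrA !subrK.
have := ler_normB ((g z' - f k z') + (f k z' - f k z)) (g z - f k z).
have := ler_normD (g z' - f k z') (f k z' - f k z).
set a := `|_|; set b := `|_|; set c := `|_|; set d' := `|_|; set e' := `|_|.
lra.
Qed.

Lemma cvx_near (R : realType) (W : normedModType R) (A : set W) c r :
  cvx A -> cvx [set y | A y /\ `|y - c| < r].
Proof.
move=> cA x y t [Ax xr] [Ay yr] t0 t1; split; first exact: cA.
(* An open ball is the thickening of its centre. *)
have : [set w : W | exists2 y, [set c] y & `|w - y| < r] (t *: x + (1 - t) *: y).
  apply: cvx_thick => //; [|by exists c|by exists c].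
  by move=> _ _ s -> -> _ _; rewrite -scalerDl addrC subrK scale1r.
by move=> [_ ->].
Qed.

(** Successive approximation: if [f] is within [h k] of [T], then [T] cut down to the balls of
    radius [h k] about [f] is still lower semicontinuous with non-empty convex values, and has an
    approximate selection to within [h k.+1]. The uniform limit lands in the closure. *)
Lemma michael_closure (R : realType) (V : normedModType R) n (E : set V)
    (T : V -> set 'rV[R]_n) :
  compact E -> lsc_on E T -> (forall z, E z -> cvx (T z)) ->
  (forall z, E z -> T z !=set0) ->
  exists f : V -> 'rV[R]_n, cont_on E f /\ forall z, E z -> closure (T z) (f z).
Proof.
move=> cE lT cT T0.
pose h k : R := 2^-1 ^+ k; have h0 k : 0 < h k by rewrite exprn_gt0.
pose P k (f : V -> 'rV[R]_n) := cont_on E f /\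
  forall z, E z -> exists2 y, T z y & `|f z - y| < h k.
pose r k (f g : V -> 'rV[R]_n) := forall z, E z -> `|g z - f z| <= 2 * h k.
have [|k f [cf fP]|u uP] := @dep_choice_seq _ P r.
- exact: approx_selection.
- have [||g [cg gP]] := approx_selection cE (lsc_on_near (r := h k) lT cf) _ _ (h0 k.+1).
  + by move=> z Ez; apply: cvx_near; exact: cT.
  + by move=> z Ez; have [y Ty fy] := fP z Ez; exists y; split => //; rewrite distrC.
  exists g; first by split => // z /gP[y [Ty _] gy]; exists y.
  move=> z /gP[y [Ty yf] gy]; rewrite -[g z - f z](subrKA y).
  rewrite (le_trans (ler_normD _ _))// mulr2n mulrDl mul1r lerD ?ltW//.
  by rewrite (lt_le_trans gy)// /h exprS ler_piMl ?invf_le1 ?ler1n// ltW.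
(* The 4 is twice the 2 in [r], by [geometric_lim]; the 5 below adds the distance [h k] from [u k z]
   to [T z]. *)
have /choice[f fP] : forall z, exists l, E z -> forall k, `|l - u k z| <= 4 * h k.
  move=> z; have [Ez|nEz] := pselect (E z); last by exists 0.
  have [l lP] := @geometric_lim _ _ (fun k => u k z) 2 (fun k => (uP k).2 z Ez).
  by exists l => _ k; rewrite (le_trans (lP k))// -natrM.
exists f; split.
  apply: (cont_on_unif (fun k => (uP k).1.1)) => e e0.
  have [k kP] := half_pow_lt 4 e0; exists k => z Ez.
  by rewrite (le_lt_trans (fP z Ez k)).
move=> z Ez B /nbhs_ballP[e /= e0 fB].
have [k kP] := half_pow_lt 5 e0.
have [y Ty uy] := (uP k).1.2 z Ez; exists y; split => //; apply: fB.
rewrite -ball_normE /= -(subrKA (u k z)) (le_lt_trans (ler_normD _ _))//.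
have := fP z Ez k; move: kP uy; rewrite -/(h k); set a := `|_|; set b := `|_|; lra.
Qed.

(** * Euclidean projection *)

Definition dot (R : realType) n (x y : 'rV[R]_n) : R :=
  \sum_(i < n) x ord0 i * y ord0 i.

Section Dot.
Variables (R : realType) (n : nat).
Implicit Types x y z : 'rV[R]_n.

Lemma dotC x y : dot x y = dot y x.
Proof. by apply: eq_bigr => i _; rewrite mulrC. Qed.

Lemma dotDr x y z : dot x (y + z) = dot x y + dot x z.
Proof. by rewrite -big_split; apply: eq_bigr => i _; rewrite mxE mulrDr. Qed.

Lemma dotZr t x y : dot x (t *: y) = t * dot x y.
Proof. by rewrite big_distrr; apply: eq_bigr => i _; rewrite mxE mulrCA. Qed.

Lemma dotNr x y : dot x (- y) = - dot x y.
Proof. by rewrite -scaleN1r dotZr mulN1r. Qed.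

Lemma dotBr x y z : dot x (y - z) = dot x y - dot x z.
Proof. by rewrite dotDr dotNr. Qed.

Lemma dotZl t x y : dot (t *: x) y = t * dot x y.
Proof. by rewrite dotC dotZr dotC. Qed.

Lemma dotBl x y z : dot (x - y) z = dot x z - dot y z.
Proof. by rewrite dotC dotBr !(dotC z). Qed.

Lemma dot0l x : dot 0 x = 0.
Proof. by rewrite -(subrr x) dotBl subrr. Qed.

Lemma dot_ge0 x : 0 <= dot x x.
Proof. by apply: sumr_ge0 => i _; rewrite -expr2 sqr_ge0. Qed.

Lemma dot_le_norm x y : `|dot x y| <= n%:R * `|x| * `|y|.
Proof.
rewrite (le_trans (ler_norm_sum _ _ _))//.
rewrite -[X in X%:R](card_ord n) -mulrA mulr_natl -sumr_const ler_sum// => i _.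
by rewrite normrM ler_pM// rV_norm_coord.
Qed.

Lemma sqr_norm_le_dot x : `|x| ^+ 2 <= dot x x.
Proof.
rewrite -[leRHS]sqr_sqrtr ?dot_ge0// ler_sqr ?nnegrE ?sqrtr_ge0//.
apply/rV_norm_leP => [|i]; first exact: sqrtr_ge0.
rewrite -sqrtr_sqr ler_wsqrtr// /dot (bigD1 i)//= expr2 lerDl.
by apply: sumr_ge0 => j _; rewrite -expr2 sqr_ge0.
Qed.

Lemma dot_eq0 x : dot x x = 0 -> x = 0.
Proof.
move=> x0; apply/normr0_eq0/eqP; rewrite -sqrf_eq0 eq_le sqr_ge0 andbT.
by rewrite -x0 sqr_norm_le_dot.
Qed.

Lemma enormE x : enorm x = Num.sqrt (dot x x).
Proof. by congr Num.sqrt; apply: eq_bigr => i _; rewrite expr2. Qed.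

Lemma dot_self_continuous (T : topologicalType) (f : T -> 'rV[R]_n) :
  continuous f -> continuous (fun t => dot (f t) (f t)).
Proof.
move=> cf t; apply: cvg_big; first exact: add_continuous.
have cfi i : (f u) ord0 i @[u --> t] --> (f t) ord0 i.
  exact: (cvg_comp _ _ (cf t) (@coord_continuous _ _ _ _ _ _)).
by move=> i _; apply: cvgM; exact: cfi.
Qed.

Lemma cvx_of_convex_set (A : set 'rV[R]_n) : convex_set A -> cvx A.
Proof.
move=> cA x y t Ax Ay t0 t1.
by have /set_mem := cA x y (Itv01 t0 t1) (mem_set Ax) (mem_set Ay).
Qed.

Lemma proj_set_exists (C : set 'rV[R]_n) z : closed C -> C !=set0 ->
  exists x, proj_set C z x.
Proof.
move=> clC [c Cc]; pose q x := dot (z - x) (z - x).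
have cq : continuous q.
  have zc : continuous (fun u : 'rV[R]_n => z - u).
    by move=> u; apply: continuousB; [exact: cst_continuous|exact: cvg_id].
  exact: dot_self_continuous zc.

(* Restricting to the sublevel set through [c] gives a compact set that contains every minimizer. *)
pose A := C `&` [set x | q x <= q c].
have [|||x /set_mem[Cx xc] xmin] := @EVT_min_rV R n q A.
- by exists c; split => //=.
- apply: bounded_closed_compact.
    exists (`|z| + Num.sqrt (q c)); split; first exact: num_real.
    move=> M Mt x [_ /= xc]; apply/ltW; apply: le_lt_trans Mt.
    rewrite -[x](subKr z) (le_trans (ler_normB _ _))// lerD2l.
    rewrite -[leLHS]ger0_norm// -sqrtr_sqr.
    by rewrite ler_wsqrtr// (le_trans (sqr_norm_le_dot _)).
  apply: closedI => //; apply: (@preimage_closed _ _ q [set r | r <= q c]).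
    by move=> x _; exact: cq.
  exact: closed_le.
- by apply: continuous_subspaceT => x; exact: cq.
exists x; split => // w Cw; rewrite !enormE ler_wsqrtr//.
have [wc|cw] := leP (q w) (q c); first by apply: xmin; exact: mem_set.
by rewrite (le_trans xc)// ltW.
Qed.

(** Variational inequality: moving from [x] towards [w] by a fraction [t] changes the squared
    distance to [z] by [t ^ 2 * b - 2 * t * a], which is negative for small [t] if [a > 0]. *)
Lemma proj_set_dot (C : set 'rV[R]_n) z x w : cvx C -> proj_set C z x -> C w ->
  dot (z - x) (w - x) <= 0.
Proof.
move=> cC [Cx xmin] Cw; rewrite leNgt; apply/negP => a0.
pose a := dot (z - x) (w - x); pose b := dot (w - x) (w - x).
have b0 : 0 <= b := dot_ge0 _.
(* This gives [t * b <= a < 2 * a]; adding 1 to [b] keeps the denominator positive. *)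
pose t := Num.min 1 (a / (b + 1)).
have b1 : 0 < b + 1 by rewrite ltr_wpDl.
have t0 : 0 < t by rewrite lt_min ltr01 divr_gt0.
have t1 : t <= 1 by rewrite ge_min lexx.
have tb : t * (b + 1) <= a by rewrite -ler_pdivlMr// ge_min lexx orbT.
have := xmin _ (cC w x t Cw Cx (ltW t0) t1).
rewrite !enormE ler_sqrt ?dot_ge0//.
have -> : z - (t *: w + (1 - t) *: x) = (z - x) - t *: (w - x).
  by apply/rowP => i; rewrite !mxE; ring.
rewrite /a /b in b0 tb *; clear -t0 tb a0 b0.
move: (z - x) (w - x) a0 b0 tb => u v a0 b0 tb.
rewrite dotBl !dotBr !dotZl !dotZr (dotC v u); nra.
Qed.

(** Adding the two variational inequalities bounds [dot (x' - x) (x' - x)] by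
    [dot (z' - z) (x' - x)]; the factor [n] comes from passing to the sup norm. *)
Lemma proj_set_lip (C : set 'rV[R]_n) z z' x x' : cvx C ->
  proj_set C z x -> proj_set C z' x' -> `|x' - x| <= n%:R * `|z' - z|.
Proof.
move=> cC zx zx'; have := proj_set_dot cC zx zx'.1.
have := proj_set_dot cC zx' zx.1.
have le : dot (x' - x) (x' - x) <= dot (z' - z) (x' - x) -> `|x' - x| <= n%:R * `|z' - z|.
  move=> h; have [->|xx0] := eqVneq (x' - x) 0; first by rewrite normr0 mulr_ge0.
  rewrite -(ler_pM2r (_ : 0 < `|x' - x|)) ?normr_gt0// -expr2.
  rewrite (le_trans (sqr_norm_le_dot _))// (le_trans h)//.
  by rewrite (le_trans (ler_norm _))// dot_le_norm.
move=> h1 h2; apply: le; rewrite !(dotBl, dotBr) in h1 h2 *; lra.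
Qed.

End Dot.

(** * Separation and averages in convex sets *)

Definition simplex (R : realType) k : set 'rV[R]_k :=
  [set t | (forall i, 0 <= t ord0 i) /\ \sum_i t ord0 i = 1].

Lemma simplex_compact (R : realType) k : compact (@simplex R k).
Proof.
apply: bounded_closed_compact.
  exists 1; split; first exact: num_real.
  move=> M M1 t [t0 t1]; apply: le_trans (ltW M1).
  apply/rV_norm_leP => // i; rewrite ger0_norm// -t1 (bigD1 i)//= lerDl.
  by apply: sumr_ge0.
have -> : @simplex R k =
    \bigcap_i ((fun t : 'rV[R]_k => t ord0 i) @^-1` [set r | 0 <= r]) `&`
    ((fun t : 'rV[R]_k => \sum_i t ord0 i) @^-1` [set 1]).
  apply/seteqP; split => t [t0 t1]; split => // i; first by move=> _; exact: t0.
  exact: t0.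
apply: closedI.
  apply: closed_bigI => i _; apply: preimage_closed (@closed_ge R 0) => t _.
  exact: coord_continuous.
have sumc : continuous (fun t : 'rV[R]_k => \sum_i t ord0 i).
  apply: continuous_big; first exact: add_continuous.
  by move=> i _; exact: coord_continuous.
by apply: preimage_closed (@closed_eq R 1) => t _; exact: sumc.
Qed.

(** Take for [p] the projection of 0 onto the convex hull of the [F i]; the variational inequality
    gives [dot p (F i) >= dot p p]. *)
Lemma gordan (R : realType) n k (A : set 'rV[R]_n) (F : 'I_k.+1 -> 'rV[R]_n) :
  cvx A -> ~ A 0 -> (forall i, A (F i)) ->
  exists2 p, A p & forall i, 0 <= dot p (F i).
Proof.
move=> cA A0 AF; pose g (t : 'rV[R]_k.+1) := \sum_i t ord0 i *: F i.
have cg : continuous g.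
  apply: continuous_big; first exact: add_continuous.
  move=> i _ t; have := @coord_continuous R 1 k.+1 ord0 i t.
  exact: (@cvgZr_tmp _ _ _ (nbhs t)).
have Ag t : simplex t -> A (g t).
  move=> [t0 t1]; have := @cvx_sum _ _ A _ (index_enum 'I_k.+1) (fun i => t ord0 i) F cA t0.
  by rewrite t1 invr1 scale1r; apply.
have s0 : @simplex R k.+1 (\row_j (j == ord0)%:R).
  split => [i|]; first by rewrite mxE ler0n.
  rewrite (bigD1 ord0)//= mxE eqxx big1 ?addr0// => i i0.
  by rewrite mxE (negbTE i0).
have [||t /set_mem ts tmin] := @EVT_min_rV R _ (fun t => dot (g t) (g t)) _ _ (@simplex_compact R k.+1).
- by exists (\row_j (j == ord0)%:R).
- by apply: continuous_subspaceT; exact: dot_self_continuous cg.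
have gproj : proj_set [set g t | t in @simplex R k.+1] 0 (g t).
  split; first by exists t.
  move=> _ [u us <-]; rewrite !sub0r !enormE; apply: ler_wsqrtr.
  by rewrite !dotNr !(dotC (- _)) !dotNr !opprK; apply: tmin; exact: mem_set.
have cvxg : cvx [set g t | t in @simplex R k.+1].
  move=> _ _ s [u [u0 u1] <-] [v [v0 v1] <-] s0' s1.
  exists (s *: u + (1 - s) *: v).
    split => [i|]; first by rewrite !mxE addr_ge0// mulr_ge0// subr_ge0.
    under eq_bigr do rewrite !mxE.
    by rewrite big_split /= -!big_distrr /= u1 v1; ring.
  rewrite /g !scaler_sumr -big_split /=; apply: eq_bigr => i _.
  by rewrite !scalerA -scalerDl; congr (_ *: _); rewrite !mxE.
exists (g t); first exact: Ag.
move=> i; have Fi : [set g t | t in @simplex R k.+1] (F i).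
  exists (\row_j (j == i)%:R).
    split => [j|]; first by rewrite mxE ler0n.
    rewrite (bigD1 i)//= mxE eqxx big1 ?addr0// => j ji.
    by rewrite mxE (negbTE ji).
  rewrite /g (bigD1 i)//= mxE eqxx scale1r big1 ?addr0// => j ji.
  by rewrite mxE (negbTE ji) scale0r.
have := proj_set_dot cvxg gproj Fi.
rewrite sub0r dotC dotNr oppr_le0 dotC dotBr subr_ge0.
by apply: le_trans; exact: dot_ge0.
Qed.

Lemma mulmx_tr_dot (R : realType) n (x y : 'rV[R]_n) : x *m y^T = (dot x y)%:M.
Proof.
apply/matrixP => i j; rewrite !ord1 !mxE eqxx mulr1n.
by apply: eq_bigr => k _; rewrite !mxE.
Qed.

(* The row space of [B] is the span of [A]. *)
Lemma minimal_subspace (R : realType) n (A : set 'rV[R]_n) :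
  exists B : 'M[R]_n, (forall b, A b -> (b <= B)%MS) /\
    forall q, (q <= B)%MS -> q != 0 -> exists2 b, A b & dot q b != 0.
Proof.
pose P r := `[< exists2 B : 'M[R]_n, \rank B = r & forall b, A b -> (b <= B)%MS >].
have exP : exists r, P r.
  exists (\rank (1%:M : 'M[R]_n)); apply/asboolP; exists 1%:M => // b _.
  exact: submx1.
case: (ex_minnP exP) => r /asboolP[B rB AB] rmin; exists B; split => // q qB q0.
(* If [q] were orthogonal to [A], the part of [B] orthogonal to [q] would still contain [A]. By
   minimality of the rank it is all of [B], so [q] is orthogonal to itself. *)
apply: contrapT => nb.
have Aq b : A b -> (b <= kermx q^T)%MS.
  move=> Ab; apply/sub_kermxP; rewrite mulmx_tr_dot dotC.
  have [->|d0] := eqVneq (dot q b) 0; first by rewrite raddf0.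
  by case: nb; exists b.
have /rmin : P (\rank (B :&: kermx q^T)%MS).
  by apply/asboolP; exists (B :&: kermx q^T)%MS => // b Ab; rewrite sub_capmx AB ?Aq.
rewrite -rB => rle; have : (B <= B :&: kermx q^T)%MS.
  by rewrite -(geq_leqif (mxrank_leqif_sup (capmxSl _ _))).
rewrite sub_capmx => /andP[_ /(submx_trans qB)/sub_kermxP].
rewrite mulmx_tr_dot => /matrixP/(_ ord0 ord0); rewrite !mxE eqxx mulr1n.
by move=> /dot_eq0 /eqP; rewrite (negbTE q0).
Qed.

Lemma closure_near (R : realType) (V : normedModType R) (A : set V) x e :
  closure A x -> 0 < e -> exists2 y, A y & `|x - y| < e.
Proof.
move=> Ax e0; have [y [Ay]] := Ax _ (nbhsx_ballx x e e0).
by rewrite -ball_normE /=; exists y.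
Qed.

(** [gordan] handles points of [A] approximating finitely many [a j], and the normalized vectors
    obtained cluster at some [q]. They lie in the span of [A], hence so does [q]; being nonzero, it
    is not orthogonal to all the [a j], whence the strict inequality. *)
Lemma proper_separation (R : realType) n (A : set 'rV[R]_n) (a : nat -> 'rV[R]_n) :
  cvx A -> ~ A 0 -> A !=set0 -> (forall j, closure A (a j)) ->
  (forall b, A b -> forall e, 0 < e -> exists j, `|a j - b| < e) ->
  exists p, (forall j, 0 <= dot p (a j)) /\ exists j, 0 < dot p (a j).
Proof.
move=> cA A0 [b0 Ab0] Aa adense; have [B [AB Bmin]] := minimal_subspace A.
have /choice[X XP] : forall k, exists q : 'rV[R]_n, [/\ `|q| = 1, (q <= B)%MS &
    forall j, (j <= k)%N ->
      exists2 y, `|a j - y| < k.+1%:R^-1 & 0 <= dot q y].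
  move=> k; have k0 : 0 < k.+1%:R^-1 :> R by rewrite invr_gt0.
  have /choice[F FP] : forall j : 'I_k.+1, exists y, A y /\ `|a j - y| < k.+1%:R^-1.
    by move=> j; have [y Ay ay] := closure_near (Aa j) k0; exists y.
  have [p Ap pF] := gordan cA A0 (fun j => (FP j).1).
  have p0 : 0 < `|p| by rewrite normr_gt0; apply: contra_notN A0 => /eqP <-.
  exists (`|p|^-1 *: p); split.
  - by rewrite normrZ normfV normr_id mulVf// gt_eqF.
  - exact/scalemx_sub/AB.
  - move=> j jk; exists (F (Ordinal (jk : (j < k.+1)%N))); last first.
      by rewrite dotZl mulr_ge0 ?invr_ge0.
    by have [] := FP (Ordinal (jk : (j < k.+1)%N)).
have Xcube k : cube n 1 (X k) by have [X1 _ _] := XP k; rewrite /cube /= X1.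
have [q _ qX] := compact_seq_cluster (@cube_compact R n 1) Xcube.
have q0 : q != 0.
  apply/eqP => q0; have [k _] := qX _ ltr01 0%N.
  by have [X1 _ _] := XP k; rewrite q0 subr0 X1 ltxx.
have dot_lim y e : 0 < e -> forall N0, exists2 k, (N0 <= k)%N &
    `|dot (X k) y - dot q y| < e.
  move=> e0 N0; have ny : 0 < 1 + n%:R * `|y| by rewrite ltr_pwDl// mulr_ge0.
  have [k N0k kX] := qX _ (divr_gt0 e0 ny) N0; exists k => //.
  rewrite -dotBl (le_lt_trans (dot_le_norm _ _))//.
  move: kX; rewrite ltr_pdivlMr// => /(le_lt_trans _); apply.
  by rewrite mulrAC mulrC ler_wpM2l// lerDr.
(* Membership in the row space amounts to linear equations, one for each column of [cokermx B], and
   these pass to the limit. *)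
have qB : (q <= B)%MS.
  rewrite submxE; apply/eqP/matrixP => i j; rewrite ord1 [in RHS]mxE.
  pose w := (col j (cokermx B))^T.
  have wE x : (x *m cokermx B) ord0 j = dot x w.
    by rewrite mxE; apply: eq_bigr => l _; rewrite !mxE.
  rewrite wE; apply/eqP; rewrite -normr_le0; apply/ler_addgt0Pl => e e0.
  rewrite addr0; have [k _] := dot_lim w e e0 0%N.
  have [_ + _] := XP k; rewrite submxE => /eqP XB.
  by rewrite -(wE (X k)) XB mxE sub0r normrN => /ltW.
have qa j : 0 <= dot q (a j).
  rewrite -oppr_le0; apply/ler_addgt0Pl => e e0; rewrite addr0.
  have e2 : 0 < e / 2 by rewrite divr_gt0.
  have n0 : 0 < 1 + n%:R :> R by rewrite ltr_pwDl.
  have [N0 N0P] := invS_lt (divr_gt0 e2 n0).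
  have [k] := dot_lim (a j) _ e2 (maxn N0 j).
  rewrite geq_max => /andP[/N0P Nk jk] + .
  have [X1 _ /(_ j jk)[y ay Xy]] := XP k.
  have : `|dot (X k) (a j - y)| <= e / 2.
    rewrite (le_trans (dot_le_norm _ _))// X1 mulr1 ltW//.
    have : `|a j - y| < e / 2 / (1 + n%:R) := lt_trans ay Nk.
    rewrite ltr_pdivlMr// => /(le_lt_trans _); apply.
    by rewrite mulrC ler_wpM2l// lerDr.
  rewrite dotBr ler_norml ltr_norml => /andP[? ?] /andP[? ?]; lra.
exists q; split => //; apply: contrapT => nj.
have qa0 j : dot q (a j) = 0.
  apply/eqP; rewrite eq_le qa andbT leNgt; apply/negP => qj.
  by apply: nj; exists j.
have [b Ab /eqP] := Bmin q qB q0; apply.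
apply/eqP; rewrite -normr_le0; apply/ler_addgt0Pl => e e0; rewrite addr0.
have nq : 0 < 1 + n%:R * `|q| by rewrite ltr_pwDl// mulr_ge0.
have [j jb] := adense b Ab _ (divr_gt0 e0 nq).
rewrite -[dot q b]opprK normrN -[- _]add0r -(qa0 j) -dotBr.
rewrite (le_trans (dot_le_norm _ _))// ltW//.
move: jb; rewrite ltr_pdivlMr// => /(le_lt_trans _); apply.
by rewrite mulrC ler_wpM2l// lerDr.
Qed.

(** If [s] were outside [A], proper separation would give [p] nonnegative on all [a j - s] and
    positive on one of them. But the weights [2^-(j+1)] are positive with sum 1, so the weighted sum
    of the [a j - s] is 0. *)
Lemma cvx_average (R : realType) n (A : set 'rV[R]_n) (a : nat -> 'rV[R]_n)
    (s : 'rV[R]_n) (c : R) :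
  cvx A -> A !=set0 -> (forall j, closure A (a j)) ->
  (forall b, A b -> forall e, 0 < e -> exists j, `|a j - b| < e) ->
  (forall k, `|s - \sum_(j < k) 2^-1 ^+ j.+1 *: a j| <= c * 2^-1 ^+ k) ->
  A s.
Proof.
move=> cA [b0 Ab0] Aa adense sP; apply: contrapT => nAs.
pose A' := [set x | A (x + s)].
have [|||||p [pa [j0 pj0]]] := @proper_separation R n A' (fun j => a j - s).
- move=> x y t Ax Ay t0 t1; rewrite /A' /=.
  have -> : t *: x + (1 - t) *: y + s = t *: (x + s) + (1 - t) *: (y + s).
    by apply/rowP => i; rewrite !mxE; ring.
  exact: cA.
- by rewrite /A' /= add0r.
- by exists (b0 - s); rewrite /A' /= subrK.
- move=> j U /nbhs_ballP[e /= e0 eU]; have [y Ay ay] := closure_near (Aa j) e0.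
  exists (y - s); split; first by rewrite /A' /= subrK.
  by apply: eU; rewrite -ball_normE /= opprB addrA subrK.
- move=> b /= Ab e e0; have [j jb] := adense _ Ab e e0; exists j.
  by rewrite -addrA -opprD (addrC s).
pose h k : R := 2^-1 ^+ k.
have h0 k : 0 < h k by rewrite exprn_gt0.
have hsum k : \sum_(j < k) h j.+1 = 1 - h k.
  elim: k => [|k IH]; first by rewrite big_ord0 /h expr0 subrr.
  by rewrite big_ord_recr /= IH /h exprS; field.
have Snorm k : `|\sum_(j < k) h j.+1 *: (a j - s)| <= (c + `|s|) * h k.
  have -> : \sum_(j < k) h j.+1 *: (a j - s) =
      - (s - \sum_(j < k) h j.+1 *: a j) + h k *: s.
    rewrite opprB; under eq_bigr do rewrite scalerBr.
    rewrite sumrB -scaler_suml hsum scalerBl scale1r opprB.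
    by rewrite addrA addrAC.
  rewrite (le_trans (ler_normD _ _))// normrN normrZ (ger0_norm (ltW (h0 k))).
  by rewrite mulrDl lerD// ?sP// mulrC.
(* The term of index [j0] alone keeps every later partial sum above [eta], whereas [Snorm] forces
   the partial sums to 0. *)
pose eta := h j0.+1 * dot p (a j0 - s).
have eta0 : 0 < eta by rewrite mulr_gt0.
have [k kP] := half_pow_lt (n%:R * `|p| * (c + `|s|)) eta0.
have dotS m : (j0 < m)%N -> eta <= dot p (\sum_(j < m) h j.+1 *: (a j - s)).
  move=> jm.
  have -> : dot p (\sum_(j < m) h j.+1 *: (a j - s)) =
      \sum_(j < m) h j.+1 * dot p (a j - s).
    elim: m {jm} => [|m IH]; first by rewrite !big_ord0 dotC dot0l.
    by rewrite !big_ord_recr /= -IH -dotZr -dotDr.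
  rewrite (bigD1 (Ordinal jm))//= lerDl; apply: sumr_ge0 => i _.
  by rewrite mulr_ge0// ltW.
have := dotS (k + j0.+1)%N; rewrite addnS ltnS leq_addl => /(_ isT).
rewrite -addnS; set m := (k + j0.+1)%N => etaS.
have hm : h m <= h k.
  by rewrite ler_wiXn2l ?invr_ge0 ?invf_le1 ?ler1n ?leq_addr.
have c0 : 0 <= c + `|s|.
  by have := Snorm 0%N; rewrite /h expr0 mulr1; apply: le_trans.
move: kP; rewrite ltNge => /negP; apply.
rewrite (le_trans etaS)// (le_trans (ler_norm _))// (le_trans (dot_le_norm _ _))//.
rewrite -[leRHS]mulrA ler_wpM2l ?mulr_ge0// (le_trans (Snorm m))//.
by rewrite ler_wpM2l.
Qed.

(** * Exact selections *)

(** Rational points are coded by integer numerators and a common denominator, so that the codes form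
    a countable type. *)
Definition grid_pt (R : realType) n (N : nat) (q : 'rV[int]_n) : 'rV[R]_n :=
  \row_i ((q ord0 i)%:~R / N.+1%:R).

Lemma grid_pt_near (R : realType) n N (y : 'rV[R]_n) :
  exists q, `|y - grid_pt R N q| <= N.+1%:R^-1.
Proof.
exists (\row_i Num.floor (y ord0 i * N.+1%:R)); apply/rV_norm_leP.
  by rewrite invr_ge0.
move=> i; rewrite !mxE; set u := y ord0 i * N.+1%:R.
have N0 : N.+1%:R != 0 :> R by rewrite pnatr_eq0.
have -> : y ord0 i - (Num.floor u)%:~R / N.+1%:R = (u - (Num.floor u)%:~R) / N.+1%:R.
  by rewrite mulrBl /u mulfK.
rewrite normrM normfV [X in _ / X]ger0_norm// ler_piMl ?invr_ge0//.
have /andP[u1 u2] := floor_itv u; rewrite ger0_norm ?subr_ge0//.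
by move: u2; rewrite intrD; lra.
Qed.

Lemma lsc_selection (R : realType) n (E : set 'rV[R]_n)
    (T : 'rV[R]_n -> set 'rV[R]_n) (M : R) :
  compact E -> lsc_on E T -> (forall z, E z -> cvx (T z)) ->
  (forall z, E z -> T z !=set0) -> (forall z, E z -> T z `<=` cube n M) ->
  exists f, cont_on E f /\ forall z, E z -> T z (f z).
Proof.
move=> cE lT cT T0 TM.
(* An index encodes a closed ball of centre [ct i] and an open ball of centre
   [dt i], all rational; the patched map [U i] takes values in the latter over
   the former whenever [T] meets it everywhere there. *)
pose I := (nat * 'rV[int]_n * nat * 'rV[int]_n)%type.
pose ct (i : I) := grid_pt R i.1.1.1 i.1.1.2; pose cr (i : I) : R := i.1.1.1.+1%:R^-1.
pose dt (i : I) := grid_pt R i.1.2 i.2; pose dr (i : I) : R := 2 * i.1.2.+1%:R^-1.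
pose T' i z := [set y | T z y /\ `|y - dt i| < dr i].
(* The second factor does not depend on the point, so [F i] is either the closed ball or empty. *)
pose F i := [set z : 'rV[R]_n | `|z - ct i| <= cr i] `&`
  [set _ | forall z', E z' -> `|z' - ct i| <= cr i -> T' i z' !=set0].
have clF i : closed (F i).
  apply: closedI; first exact: closed_norm_ball.
  set Q := (X in [set _ | X]); have [HQ|nQ] := pselect Q.
    by rewrite (_ : [set _ | _] = setT); [exact: closedT|apply/seteqP; split].
  by rewrite (_ : [set _ | _] = set0); [exact: closed0|apply/seteqP; split].
pose U i z := [set y | T z y /\ (F i z -> T' i z y)].
have /choice[g gP] : forall i, exists g, cont_on E g /\
    forall z, E z -> closure (U i z) (g z).
  move=> i; apply: michael_closure => //.
  - apply: lsc_on_patch => //; last by move=> z _ y [].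
    have cc : cont_on E (fun=> dt i).
      by move=> z _ e e0; exists 1 => // z' _ _; rewrite subrr normr0.
    move=> z y [Ez Fz] Ty e e0; have [d d0 Td] := lsc_on_near lT cc Ez Ty e0.
    by exists d => // z' [Ez' _]; exact: Td.
  - move=> z Ez x y t [Tx xF] [Ty yF] t0 t1; split; first exact: cT.
    move=> Fz; have := @cvx_near _ _ _ (dt i) (dr i) (cT z Ez) x y t.
    by apply => //; [exact: xF|exact: yF].
  - move=> z Ez; have [Fz|nFz] := pselect (F i z).
      have [zi /(_ z Ez zi)[y T'y]] := Fz; exists y; split => //.
      by have [] := T'y.
    by have [y Ty] := T0 z Ez; exists y.
(* A number that codes no index gets a fixed default index, so that [a] is total. *)
pose a (j : nat) := g (odflt (0%N, 0, 0%N, 0) (choice.unpickle j)).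
have aT z j : E z -> closure (T z) (a j z).
  by move=> Ez; apply: closure_subset ((gP _).2 z Ez) => y [].
pose h k : R := 2^-1 ^+ k.
have h0 k : 0 < h k by rewrite exprn_gt0.
pose S k z := \sum_(j < k) h j.+1 *: a j z.
have aM z j : E z -> `|a j z| <= M.
  move=> Ez; apply/ler_addgt0Pr => e e0.
  have [y Ty ay] := closure_near (aT z j Ez) e0.
  rewrite -(subrK y (a j z)) (le_trans (ler_normD _ _))// addrC lerD//; last exact: ltW.
  exact: (TM z Ez y Ty).
have ca j : cont_on E (a j) by exact: (gP _).1.
have cS k : cont_on E (S k).
  elim: k => [|k IH] z Ez e e0.
    by exists 1 => // z' _ _; rewrite /S !big_ord0 subrr normr0.
  have e2 : 0 < e / 2 by rewrite divr_gt0.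
  have [d1 d10 Sd] := IH z Ez _ e2; have [d2 d20 ad] := ca k z Ez _ e2.
  exists (Num.min d1 d2); first by rewrite lt_min d10.
  move=> z' Ez'; rewrite lt_min => /andP[/(Sd z' Ez') Sz /(ad z' Ez') az].
  rewrite /S !big_ord_recr /= opprD addrACA -scalerBr.
  rewrite (le_lt_trans (ler_normD _ _))// [e]splitr ltrD//.
  rewrite (le_lt_trans _ az)// normrZ (gtr0_norm (h0 _)) ler_piMl//.
  by rewrite exprn_ile1 ?invr_ge0 ?invf_le1 ?ler1n.
have /choice[f fP] : forall z, exists l, E z -> forall k, `|l - S k z| <= 2 * M * h k.
  move=> z; have [Ez|nEz] := pselect (E z); last by exists 0.
  have [|l lP] := @geometric_lim _ _ (fun k => S k z) M; last by exists l.
  move=> k; rewrite /S big_ord_recr /= addrAC subrr add0r normrZ.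
  rewrite (gtr0_norm (h0 _)) mulrC ler_pM ?aM// ?(ltW (h0 _))//.
  by rewrite /h exprS ler_piMl ?invf_le1 ?ler1n// ltW.
exists f; split.
  apply: (cont_on_unif cS) => e e0.
  have [k kP] := half_pow_lt (2 * M) e0; exists k => z Ez.
  by rewrite (le_lt_trans (fP z Ez k)).
move=> z Ez; apply: (@cvx_average _ _ (T z) (fun j => a j z) _ (2 * M)).
- exact: cT.
- exact: T0.
- by move=> j; exact: aT.
(* With [b = 1 / (N2 + 1)], the path from [g i z] to [y] through [y'] and [dt i] has length below
   [b + 2 * b + b], hence the [e / 4]. *)
- move=> y Ty e e0; have e4 : 0 < e / 4 by rewrite divr_gt0.
  have [N2 /(_ _ (leqnn _)) N2e] := invS_lt e4; have [v vy] := grid_pt_near N2 y.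
  have K2 : 0 < N2.+1%:R^-1 :> R by rewrite invr_gt0.
  have [d d0 Td] := lT z y Ez Ty _ K2; have d2 : 0 < d / 2 by rewrite divr_gt0.
  (* A ball of radius below [d / 2] that contains [z] stays within [d] of [z], so [T] meets the
     target ball all over it. *)
  have [N1 /(_ _ (leqnn _)) N1d] := invS_lt d2; have [q qz] := grid_pt_near N1 z.
  pose i : I := (N1, q, N2, v); exists (choice.pickle i); rewrite /a choice.pickleK /=.
  have Fz : F i z.
    split; first exact: qz.
    move=> z' Ez' z'q; have [|y' Ty' y'y] := Td z' Ez'.
      rewrite -(subrKA (ct i)) (le_lt_trans (ler_normD _ _))// [d]splitr.
      by rewrite ltrD// ?(le_lt_trans z'q)// distrC (le_lt_trans qz).
    exists y'; split => //; rewrite -(subrKA y) (le_lt_trans (ler_normD _ _))//.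
    by rewrite /dr mulr2n mulrDl mul1r ltr_leD.
  have [y' [_ /(_ Fz)[_ y'v]] gy'] := closure_near ((gP i).2 z Ez) K2.
  have -> : g i z - y = (g i z - y') + (y' - dt i) - (y - dt i).
    by rewrite opprB !addrA !subrK.
  rewrite (le_lt_trans (ler_normB _ _))//.
  have := ler_normD (g i z - y') (y' - dt i).
  have dr2 : dr i = 2 * N2.+1%:R^-1 by [].
  move: (vy : `|y - dt i| <= _) gy' y'v N2e; rewrite dr2.
  move: `|g i z - y' + (y' - dt i)| `|y - dt i| `|g i z - y'| `|y' - dt i|.
  move: (N2.+1%:R^-1) => b0 b1 b2 b3 b4; lra.
- by move=> k; exact: fP.
Qed.

Lemma lsc_fixed_point (R : realType) n (M : R) (T : 'rV[R]_n -> set 'rV[R]_n) :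
  0 < M -> lsc_on (cube n M) T -> (forall z, cube n M z -> cvx (T z)) ->
  (forall z, cube n M z -> T z !=set0) ->
  (forall z, cube n M z -> T z `<=` cube n M) ->
  exists2 z, cube n M z & T z z.
Proof.
move=> M0 lT cT T0 TM.
have [f [cf fT]] := lsc_selection (@cube_compact R n M) lT cT T0 TM.
have [|z zM fz] := brouwer_cube M0 cf; first by move=> z zM; exact: TM (fT z zM).
by exists z; rewrite // -{2}fz; exact: fT.
Qed.

(** * Projected solutions *)

(** A failure at [z] yields a sequence in [X] converging to [z] along which [Phi] has no value
    within [e] of [y]; a single late index of the subnet contradicts this. *)
Lemma lsc_on_of_nets (R : realType) (V W : normedModType R) (X : set V)
    (Phi : V -> set W) : lower_semicontinuous_on X Phi -> lsc_on X Phi.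
Proof.
move=> lPhi z y Xz Phiy e e0; apply: contrapT => nd.
have /choice[x xP] : forall k, exists x, [/\ X x, `|x - z| < k.+1%:R^-1 &
    ~ exists2 y', Phi x y' & `|y' - y| < e].
  move=> k; apply: contrapT => nx; apply: nd; exists k.+1%:R^-1.
    by rewrite invr_gt0.
  move=> x Xx xz; apply: contrapT => ny; apply: nx; by exists x.
have dir : directed (fun i j : nat => (i <= j)%N).
  split; first by exists 0%N.
  - exact: leqnn.
  - by move=> i j k; exact: leq_trans.
  - by move=> i j; exists (maxn i j); rewrite leq_maxl leq_maxr.
have xz : net_cvg (fun i j : nat => (i <= j)%N) x z.
  move=> U /nbhs_ballP[d /= d0 dU]; have [N0 N0P] := invS_lt d0.
  exists N0 => // j /= N0j; apply: dU; rewrite -ball_normE /= distrC.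
  by have [_ xj _] := xP j; rewrite (lt_trans xj)// N0P.
have Xx j : X (x j) by have [] := xP j.
have [J [leJ [phi [u [[_ leJ_refl _ _] _ uy Pu]]]]] := lPhi z Xz _ _ x dir Xx xz y Phiy.
have /uy[j0 _ /(_ j0 (leJ_refl j0)) /=] := nbhsx_ballx y e e0.
rewrite -ball_normE /= distrC => uj0.
by have [_ _] := xP (phi j0); apply; exists (u j0).
Qed.

Lemma lsc_on_comp (R : realType) (U V W : normedModType R) (E : set U)
    (X : set V) (g : U -> V) (Phi : V -> set W) :
  lsc_on X Phi -> cont_on E g -> (forall z, E z -> X (g z)) ->
  lsc_on E (fun z => Phi (g z)).
Proof.
move=> lPhi cg gX z y Ez Py e e0; have [d d0 Pd] := lPhi _ y (gX z Ez) Py e e0.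
have [d' d'0 gd'] := cg z Ez d d0; exists d' => // z' Ez' z'z.
by apply: Pd; [exact: gX|exact: gd'].
Qed.

Theorem theorem5p1 (R : realType) (n : nat) (C : set 'rV[R]_n)
    (h : 'rV[R]_n -> R) (K : 'rV[R]_n -> set 'rV[R]_n)
    (C_closed : closed C) (C_convex : convex_set C) (C_nonempty : C !=set0)
    (K_nonempty : forall x, C x -> K x !=set0)
    (K_relcompact : precompact (\bigcup_(x in C) K x))
    (K_lsc : lower_semicontinuous_on C K)
    (K_convex : forall x, C x -> convex_set (K x))
    (D_closed : closed (proj_graph C K))
    (H_lsc : lower_semicontinuous_on (proj_graph C K) (improvement_map h K))
    (H_convex : forall p, proj_graph C K p -> convex_set (improvement_map h K p)) :
  exists x0, projected_solution C h K x0.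
Proof.
apply: contrapT => nosol; have cvxC := cvx_of_convex_set C_convex.
have [pi piP] := choice (fun z => proj_set_exists z C_closed C_nonempty).
have piC z : C (pi z) by have [] := piP z.
have [M M0 KM] : exists2 M : R, 0 < M & forall x, C x -> K x `<=` cube n M.
  (* [precompactE] is used to rewrite relative compactness as compactness of the closure. *)
  have [M [_ MP]] := compact_bounded (eq_ind _ id K_relcompact _ (precompactE _)).
  exists (`|M| + 1); first by rewrite ltr_wpDl.
  move=> x Cx y Kxy; apply: MP; first by rewrite ltr_pwDr// ler_norm.
  by apply: subset_closure; exists x.
have pi_lip z z' : `|pi z' - pi z| <= n%:R * `|z' - z|.
  exact: proj_set_lip cvxC (piP z) (piP z').
have pi_cvg z : pi z' @[z' --> z] --> pi z.
  apply/(@cvgrPdist_lt _ _ _ (nbhs z)) => e e0; apply/nbhs_ballP.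
  have n0 : 0 < 1 + n%:R :> R by rewrite ltr_pwDl.
  exists (e / (1 + n%:R)) => /=; first by rewrite divr_gt0.
  move=> z'; rewrite -ball_normE /= ltr_pdivlMr// => zz'.
  by rewrite (le_lt_trans (pi_lip _ _))// (le_lt_trans _ zz')// mulrC ler_wpM2l// lerDr.
pose g z := (pi z, z).
have g_cvg z : g z' @[z' --> z] --> g z.
  exact: (cvg_pair (FF := nbhs_filter z) (FG := nbhs_filter (pi z))
    (FH := nbhs_filter z) (pi_cvg z) cvg_id).
pose F := g @^-1` proj_graph C K.
have clF : closed F by apply: preimage_closed D_closed => z _; exact: g_cvg.
have lT : lsc_on (cube n M) (fun z => K (pi z)).
  apply: (lsc_on_comp (lsc_on_of_nets K_lsc)) => //.
  by apply: cvg_cont_on => z _; exact: pi_cvg.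
have lT' : lsc_on (cube n M `&` F) (fun z => improvement_map h K (g z)).
  apply: (lsc_on_comp (lsc_on_of_nets H_lsc)); last by move=> z [].
  by apply: cvg_cont_on => z _; exact: g_cvg.
have lU := lsc_on_patch clF lT lT' (fun z _ y => @proj1 _ _).
have [|||z zM [Kz Hz]] := lsc_fixed_point M0 lU.
- move=> z zM x y t [Kx Fx] [Ky Fy] t0 t1; split.
    exact: (cvx_of_convex_set (K_convex _ (piC z))).
  move=> Fz; apply: (cvx_of_convex_set (H_convex _ Fz)) => //; [exact: Fx|exact: Fy].
- move=> z zM; have [Fz|nFz] := pselect (F z); last first.
    by have [y Ky] := K_nonempty _ (piC z); exists y.
  (* On [F], an empty improvement set makes [z] a minimizer of [h] on [K (pi z)], and [pi z] a
     projected solution. *)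
  apply: contrapT => noy; apply: nosol; exists (pi z); split; first exact: piC.
  exists z; last exact: piP.
  have [_ Kz _] := Fz; split => // w Kw; rewrite leNgt; apply/negP => hw.
  by apply: noy; exists w; split.
- by move=> z zM y [Ky _]; exact: KM Ky.
(* Being a fixed point puts [z] in [K (pi z)], so the alternative off [F] cannot occur. *)
have Fz : F z by split; [exact: piC|exact: Kz|exact: piP].
by have [_] := Hz Fz; rewrite ltxx.
Qed.
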